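(* Let $K$ be a field and let $E$ be a finite directed graph admitting a source loop $c$, based at $v := s(c)$, and a sink $w$ such that $v\geq w$ (i.e. there is a path in $E$ from $v$ to $w$). Then the left $L_K(E)$-module $D(L_K(E)w)$ is divisible and not injective.
   Context: Graph and algebra. $E=(E^0,E^1,s,r)$ is a directed graph with finite sets $E^0$ of vertices and $E^1$ of edges, and source and range maps $s,r:E^1\to E^0$. A path is either a vertex (length $0$) or a sequence $e_1\cdots e_m$ of edges with $r(e_i)=s(e_{i+1})$; its source is $s(e_1)$ and its range is $r(e_m)$. A sink is a vertex that is the source of no edge. $\mathrm{Path}(E)w$ denotes the set of paths with range $w$, and $u\,\mathrm{Path}(E)w$ the set of those with moreover source $u$. The Leavitt path algebra $L_K(E)$ is the associative $K$-algebra generated by $E^0\cup E^1\cup\{e^*: e\in E^1\}$ with relations: $uu'=\delta_{u,u'}u$ for vertices $u,u'$; $s(e)e=e=e\,r(e)$; $r(e)e^*=e^*=e^*s(e)$; $e^*f=\delta_{e,f}\,r(e)$ for edges $e,f$; and $u=\sum_{s(e)=u}ee^*$ for every vertex $u$ that is not a sink. Since $E^0$ is finite, $L_K(E)$ has identity $\sum_{u\in E^0}u$. Modules are unital. Source loop. A loop is an edge $c$ with $s(c)=r(c)$; it is a source loop if $c$ is the only edge with range $r(c)$. Put $v=s(c)$, $c^0=v$, and $s^{-1}(v)=\{c,d_1,\dots,d_n\}$; the edges $d_1,\dots,d_n$ are the exits of $c$. The module $X^E_w$. $X^E_w=\{\sum_{\lambda\in\mathrm{Path}(E)w}k_\lambda\lambda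 : k_\lambda\in K\}$ is the set of all (possibly infinite) formal series of paths ending in $w$. It is a left $L_K(E)$-module via the action on paths extended coefficientwise to series: a vertex $u$ sends $\lambda$ to $\lambda$ if $s(\lambda)=u$ and to $0$ otherwise; an edge $e$ sends $\lambda$ to $e\lambda$ if $r(e)=s(\lambda)$ and to $0$ otherwise; $e^*$ sends $\lambda$ to $\lambda'$ if $\lambda=e\lambda'$ and to $0$ otherwise. Let $Y_{v,w}$ be the set of all paths from $v$ to $w$ whose first edge is one of the exits $d_1,\dots,d_n$ (not $c$). Every path from $v$ to $w$ is uniquely of the form $c^i\mu$ with $i\ge 0$, $\mu\in Y_{v,w}$. Hence for each $\xi\in X^E_w$ one has uniquely $v\xi=\sum_{\mu\in Y_{v,w}}A_\mu(c)\mu$ with $A_\mu(x)=\sum_{i\ge0} a_{\mu,i}x^i\in K[[x]]$, where $A_\mu(c)\mu:=\sum_{i\geq 0}a_{\mu,i}c^i\mu$. Let $K[x]_{\mathfrak M}$ be the localisation of $K[x]$ at $\mathfrak M=\{p(x)\in K[x] : p(0)\neq0\}$, identified with the subalgebra of $K[[x]]$ of all $f(x)g(x)^{-1}$ with $f,g\in K[x]$, $g(0)\ne0$. Then $D(L_K(E)w)$ is the submodule of $X^E_w$ $$D(L_K(E)w)=\Big\{\xi\in X^E_w : v\xi=\sum_{\mu\in Y_{v,w}}A_\mu(c)\mu \text{ with } A_\mu(x)\in K[x]_{\mathfrak M}\text{ for all }\mu\Big\}.$$ A left $R$-module $M$ is divisible if for every principal left ideal $J$ of $R$, every left $R$-homomorphism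 $J\to M$ extends to a left $R$-homomorphism $R\to M$; it is injective if this holds for every left ideal $J$ of $R$. *)

(* Defs.v *)
From HB Require Import structures.
From mathcomp Require Import all_boot all_order all_algebra.
From mathcomp Require Import boolp classical_sets functions.

Set Implicit Arguments.
Unset Strict Implicit.
Unset Printing Implicit Defensive.

Import GRing.Theory.
Local Open Scope quotient_scope.
Local Open Scope ring_scope.

Record digraph := Digraph {
  vertex : finType;
  edge : finType;
  src : edge -> vertex;
  tgt : edge -> vertex }.

Arguments src {d} _.
Arguments tgt {d} _.

Section Paths.
Variable E : digraph.

(* A path is encoded as its source together with its sequence of edges; the
   empty sequence encodes the path of length 0 at that vertex. *)
Definition prepath : Type := (vertex E * seq (edge E))%type.

Fixpoint chain (u : vertex E) (p : seq (edge E)) : bool :=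
  if p is e :: p' then (src e == u) && chain (tgt e) p' else true.

Fixpoint chain_end (u : vertex E) (p : seq (edge E)) : vertex E :=
  if p is e :: p' then chain_end (tgt e) p' else u.

Definition ends_in (w : vertex E) (p : prepath) : bool :=
  chain p.1 p.2 && (chain_end p.1 p.2 == w).

(* Path(E)w *)
Definition pathto (w : vertex E) : Type := {p : prepath | ends_in w p}.
HB.instance Definition _ (w : vertex E) := Choice.on (pathto w).
HB.instance Definition _ (w : vertex E) := SubType.on (pathto w).

Definition psrc (w : vertex E) (p : pathto w) : vertex E := (val p).1.
Definition pedges (w : vertex E) (p : pathto w) : seq (edge E) := (val p).2.

Definition is_sink (w : vertex E) : Prop := forall e : edge E, src e <> w.

Definition source_loop (c : edge E) : Prop :=
  src c = tgt c /\ forall e : edge E, tgt e = tgt c -> e = c.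

Definition reaches (v w : vertex E) : Prop :=
  exists p : pathto w, psrc p = v.

Inductive generator : Type :=
  | Vtx of vertex E
  | Edg of edge E
  | Gho of edge E.   (* e^* *)

Definition star (g : generator) : generator :=
  match g with Vtx u => Vtx u | Edg e => Gho e | Gho e => Edg e end.

(* [None] stands for the value 0. *)
Definition prepath_act (g : generator) (p : prepath) : option prepath :=
  match g with
  | Vtx u => if p.1 == u then Some p else None
  | Edg e => if tgt e == p.1 then Some (src e, e :: p.2) else None
  | Gho e => if p.2 is f :: q then if f == e then Some (tgt e, q) else None
             else None
  end.

(* [insub] never fails here, see [val_path_act]. *)
Definition path_act (w : vertex E) (g : generator) (p : pathto w) :
    option (pathto w) :=
  obind insub (prepath_act g (val p)).

Lemma prepath_act_ends w g p q :
  ends_in w p -> prepath_act g p = Some q -> ends_in w q.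
Proof.
case: p => u p; case: g => [x|e|e] //=.
- by case: eqP => // _ h [<-].
- by case: eqP => // eu h [<-]; rewrite /ends_in /= eqxx eu.
- case: p => // f p; case: eqP => // -> /andP[/= /andP[_ h1] h2] [<-].
  by rewrite /ends_in /= h1.
Qed.

Lemma val_path_act w g (p : pathto w) :
  omap val (path_act g p) = prepath_act g (val p).
Proof.
rewrite /path_act; case E1: (prepath_act g (val p)) => [q|] //=.
by rewrite (insubT (ends_in w) (prepath_act_ends (valP p) E1)).
Qed.

Lemma prepath_actK w g p q : ends_in w p ->
  prepath_act g p = Some q -> prepath_act (star g) q = Some p.
Proof.
case: p => u p; case: g => [x|e|e] //=.
- by case: (u =P x) => // -> _ [<-] /=; rewrite eqxx.
- by case: eqP => // <- _ [<-] /=; rewrite eqxx.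
- case: p => // f p; case: eqP => // -> /andP[/= /andP[/eqP <- _] _] [<-] /=.
  by rewrite eqxx.
Qed.

(* The generators act on paths by partial bijections, with g^* inverse to g. *)
Lemma path_actK w g (p q : pathto w) :
  path_act g p = Some q <-> path_act (star g) q = Some p.
Proof.
have H (h : generator) (a b : pathto w) :
    path_act h a = Some b -> path_act (star h) b = Some a.
  move=> hab; have := val_path_act h a; rewrite hab /= => /esym.
  move=> /(prepath_actK (valP a)); rewrite -val_path_act.
  by case: (path_act _ b) => //= a' [/val_inj ->].
split; first exact: H.
by move/H; case: g.
Qed.

End Paths.

Section Leavitt.
Variables (K : fieldType) (E : digraph).

(* L_K(E) is presented as the quotient of the (non-unital) algebra terms over
   the generators by the least congruence containing the axioms of associative
   K-algebras and the defining relations of L_K(E). *)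
Inductive lterm : Type :=
  | Gen of generator E
  | Zero
  | Add of lterm & lterm
  | Scale of K & lterm
  | Mul of lterm & lterm.

Local Notation V u := (Gen (Vtx u)).
Local Notation Ed e := (Gen (Edg e)).
Local Notation Gh e := (Gen (Gho e)).

Inductive lpa_eq : lterm -> lterm -> Prop :=
  | lpaeq_refl t : lpa_eq t t
  | lpaeq_sym s t : lpa_eq s t -> lpa_eq t s
  | lpaeq_trans s t u : lpa_eq s t -> lpa_eq t u -> lpa_eq s u
  | lpaeq_add s s' t t' :
      lpa_eq s s' -> lpa_eq t t' -> lpa_eq (Add s t) (Add s' t')
  | lpaeq_scale k t t' : lpa_eq t t' -> lpa_eq (Scale k t) (Scale k t')
  | lpaeq_mul s s' t t' :
      lpa_eq s s' -> lpa_eq t t' -> lpa_eq (Mul s t) (Mul s' t')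
  | lpaeq_addA s t u : lpa_eq (Add s (Add t u)) (Add (Add s t) u)
  | lpaeq_addC s t : lpa_eq (Add s t) (Add t s)
  | lpaeq_add0 t : lpa_eq (Add Zero t) t
  | lpaeq_addN t : lpa_eq (Add (Scale (-1) t) t) Zero
  | lpaeq_scaleA k l t : lpa_eq (Scale k (Scale l t)) (Scale (k * l) t)
  | lpaeq_scale1 t : lpa_eq (Scale 1 t) t
  | lpaeq_scaleDr k s t :
      lpa_eq (Scale k (Add s t)) (Add (Scale k s) (Scale k t))
  | lpaeq_scaleDl k l t :
      lpa_eq (Scale (k + l) t) (Add (Scale k t) (Scale l t))
  | lpaeq_mulA s t u : lpa_eq (Mul s (Mul t u)) (Mul (Mul s t) u)
  | lpaeq_mulDl s t u : lpa_eq (Mul (Add s t) u) (Add (Mul s u) (Mul t u))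
  | lpaeq_mulDr s t u : lpa_eq (Mul s (Add t u)) (Add (Mul s t) (Mul s u))
  | lpaeq_scaleAl k s t : lpa_eq (Scale k (Mul s t)) (Mul (Scale k s) t)
  | lpaeq_scaleAr k s t : lpa_eq (Scale k (Mul s t)) (Mul s (Scale k t))
  | lpaeq_VV u u' : lpa_eq (Mul (V u) (V u')) (if u == u' then V u else Zero)
  | lpaeq_Vedge e : lpa_eq (Mul (V (src e)) (Ed e)) (Ed e)
  | lpaeq_edgeV e : lpa_eq (Mul (Ed e) (V (tgt e))) (Ed e)
  | lpaeq_Vghost e : lpa_eq (Mul (V (tgt e)) (Gh e)) (Gh e)
  | lpaeq_ghostV e : lpa_eq (Mul (Gh e) (V (src e))) (Gh e)
  | lpaeq_CK1 e f :
      lpa_eq (Mul (Gh e) (Ed f)) (if e == f then V (tgt e) else Zero)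
  | lpaeq_CK2 u : ~ is_sink u ->
      lpa_eq (V u) (\big[Add/Zero]_(e | src e == u) Mul (Ed e) (Gh e)).

HB.instance Definition _ := gen_eqMixin lterm.
HB.instance Definition _ := gen_choiceMixin lterm.

Definition lpa_eqb (s t : lterm) : bool := `[< lpa_eq s t >].

Lemma lpa_eqb_refl : reflexive lpa_eqb.
Proof. by move=> t; apply/asboolP; exact: lpaeq_refl. Qed.

Lemma lpa_eqb_sym : symmetric lpa_eqb.
Proof. by move=> s t; apply/asboolP/asboolP; exact: lpaeq_sym. Qed.

Lemma lpa_eqb_trans : transitive lpa_eqb.
Proof.
by move=> t s u /asboolP st /asboolP tu; apply/asboolP; exact: lpaeq_trans st tu.
Qed.

Canonical lpa_equiv := EquivRel lpa_eqb lpa_eqb_refl lpa_eqb_sym lpa_eqb_trans.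

Definition LPA : Type := {eq_quot lpa_equiv}.
HB.instance Definition _ := Choice.on LPA.

Definition lpa_pi (t : lterm) : LPA := \pi_({eq_quot lpa_equiv}) t.
Definition lpa_repr (a : LPA) : lterm := repr (a : {eq_quot lpa_equiv}).

Lemma lpa_piP (s t : lterm) : lpa_pi s = lpa_pi t <-> lpa_eq s t.
Proof.
by rewrite /lpa_pi; split => [/eqmodP/asboolP|h] //; apply/eqmodP/asboolP.
Qed.

Lemma lpa_reprK (a : LPA) : lpa_pi (lpa_repr a) = a.
Proof. exact: reprK. Qed.

Lemma lpa_repr_eq (t : lterm) : lpa_eq (lpa_repr (lpa_pi t)) t.
Proof. by apply/lpa_piP; rewrite lpa_reprK. Qed.

Lemma lpa_ind (P : LPA -> Prop) : (forall t, P (lpa_pi t)) -> forall a, P a.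
Proof. by move=> h a; rewrite -(lpa_reprK a). Qed.

Definition one_term : lterm := \big[Add/Zero]_(u : vertex E) V u.

Definition lpa_zero : LPA := lpa_pi Zero.
Definition lpa_one : LPA := lpa_pi one_term.
Definition lpa_add (a b : LPA) := lpa_pi (Add (lpa_repr a) (lpa_repr b)).
Definition lpa_scale (k : K) (a : LPA) := lpa_pi (Scale k (lpa_repr a)).
Definition lpa_opp (a : LPA) := lpa_scale (-1) a.
Definition lpa_mul (a b : LPA) := lpa_pi (Mul (lpa_repr a) (lpa_repr b)).

Lemma lpa_addE s t : lpa_add (lpa_pi s) (lpa_pi t) = lpa_pi (Add s t).
Proof. by apply/lpa_piP; apply: lpaeq_add; exact: lpa_repr_eq. Qed.

Lemma lpa_scaleE k t : lpa_scale k (lpa_pi t) = lpa_pi (Scale k t).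
Proof. by apply/lpa_piP; apply: lpaeq_scale; exact: lpa_repr_eq. Qed.

Lemma lpa_mulE s t : lpa_mul (lpa_pi s) (lpa_pi t) = lpa_pi (Mul s t).
Proof. by apply/lpa_piP; apply: lpaeq_mul; exact: lpa_repr_eq. Qed.

Let lpaE := (lpa_addE, lpa_scaleE, lpa_mulE).

Lemma lpa_addA : associative lpa_add.
Proof.
elim/lpa_ind=> s; elim/lpa_ind=> t; elim/lpa_ind=> u.
by rewrite !lpaE; apply/lpa_piP; exact: lpaeq_addA.
Qed.

Lemma lpa_addC : commutative lpa_add.
Proof.
elim/lpa_ind=> s; elim/lpa_ind=> t.
by rewrite !lpaE; apply/lpa_piP; exact: lpaeq_addC.
Qed.

Lemma lpa_add0 : left_id lpa_zero lpa_add.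
Proof. by elim/lpa_ind=> s; rewrite !lpaE; apply/lpa_piP; exact: lpaeq_add0. Qed.

Lemma lpa_addN : left_inverse lpa_zero lpa_opp lpa_add.
Proof.
by elim/lpa_ind=> s; rewrite /lpa_opp !lpaE; apply/lpa_piP; exact: lpaeq_addN.
Qed.

HB.instance Definition _ :=
  GRing.isZmodule.Build LPA lpa_addA lpa_addC lpa_add0 lpa_addN.

Lemma lpa_scaleA k l a : lpa_scale k (lpa_scale l a) = lpa_scale (k * l) a.
Proof.
by elim/lpa_ind: a => s; rewrite !lpaE; apply/lpa_piP; exact: lpaeq_scaleA.
Qed.

Lemma lpa_scale1 : left_id 1 lpa_scale.
Proof. by elim/lpa_ind=> s; rewrite !lpaE; apply/lpa_piP; exact: lpaeq_scale1. Qed.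

Lemma lpa_scaleDr : right_distributive lpa_scale +%R.
Proof.
move=> k; elim/lpa_ind=> s; elim/lpa_ind=> t.
rewrite -[_ + _]/(lpa_add _ _) -[RHS]/(lpa_add _ _) !lpaE; apply/lpa_piP.
exact: lpaeq_scaleDr.
Qed.

Lemma lpa_scaleDl a : {morph lpa_scale^~ a : k l / k + l}.
Proof.
elim/lpa_ind: a => s k l; rewrite -[RHS]/(lpa_add _ _) !lpaE; apply/lpa_piP.
exact: lpaeq_scaleDl.
Qed.

HB.instance Definition _ := GRing.Zmodule_isLmodule.Build K LPA
  lpa_scaleA lpa_scale1 lpa_scaleDr lpa_scaleDl.

Lemma lpa_mulA : associative lpa_mul.
Proof.
elim/lpa_ind=> s; elim/lpa_ind=> t; elim/lpa_ind=> u.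
by rewrite !lpaE; apply/lpa_piP; exact: lpaeq_mulA.
Qed.

Lemma lpa_mulDl : left_distributive lpa_mul +%R.
Proof.
elim/lpa_ind=> s; elim/lpa_ind=> t; elim/lpa_ind=> u.
rewrite -[_ + _]/(lpa_add _ _) -[RHS]/(lpa_add _ _) !lpaE; apply/lpa_piP.
exact: lpaeq_mulDl.
Qed.

Lemma lpa_mulDr : right_distributive lpa_mul +%R.
Proof.
elim/lpa_ind=> s; elim/lpa_ind=> t; elim/lpa_ind=> u.
rewrite -[_ + _]/(lpa_add _ _) -[RHS]/(lpa_add _ _) !lpaE; apply/lpa_piP.
exact: lpaeq_mulDr.
Qed.

Lemma lpa_scaleAl k a b : lpa_scale k (lpa_mul a b) = lpa_mul (lpa_scale k a) b.
Proof.
elim/lpa_ind: a => s; elim/lpa_ind: b => t.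
by rewrite !lpaE; apply/lpa_piP; exact: lpaeq_scaleAl.
Qed.

Lemma lpa_scaleAr k a b : lpa_scale k (lpa_mul a b) = lpa_mul a (lpa_scale k b).
Proof.
elim/lpa_ind: a => s; elim/lpa_ind: b => t.
by rewrite !lpaE; apply/lpa_piP; exact: lpaeq_scaleAr.
Qed.

Lemma lpa_pi_big (I : finType) (P : pred I) (F : I -> lterm) :
  lpa_pi (\big[Add/Zero]_(i | P i) F i) = \sum_(i | P i) lpa_pi (F i).
Proof.
by apply: (big_morph lpa_pi) => // s t; rewrite -lpa_addE.
Qed.

Lemma lpa_mul0 a : lpa_mul a 0 = 0.
Proof.
by apply: (@addrI _ (lpa_mul a 0)); rewrite -lpa_mulDr !addr0.
Qed.

Lemma lpa_0mul a : lpa_mul 0 a = 0.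
Proof.
by apply: (@addrI _ (lpa_mul 0 a)); rewrite -lpa_mulDl !addr0.
Qed.

Lemma lpa_suml (I : finType) (F : I -> LPA) a :
  lpa_mul (\sum_i F i) a = \sum_i lpa_mul (F i) a.
Proof.
apply: (big_morph (lpa_mul^~ a)) => [x y|]; first exact: lpa_mulDl.
exact: lpa_0mul.
Qed.

Lemma lpa_sumr (I : finType) (F : I -> LPA) a :
  lpa_mul a (\sum_i F i) = \sum_i lpa_mul a (F i).
Proof.
apply: (big_morph (lpa_mul a)) => [x y|]; first exact: lpa_mulDr.
exact: lpa_mul0.
Qed.

Definition gsrc (g : generator E) :=
  match g with Vtx u => u | Edg e => src e | Gho e => tgt e end.
Definition gtgt (g : generator E) :=
  match g with Vtx u => u | Edg e => tgt e | Gho e => src e end.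

Lemma lpa_gsrc g : lpa_mul (lpa_pi (V (gsrc g))) (lpa_pi (Gen g)) = lpa_pi (Gen g).
Proof.
rewrite lpa_mulE; apply/lpa_piP; case: g => [u|e|e] /=.
- by have := lpaeq_VV u u; rewrite eqxx.
- exact: lpaeq_Vedge.
- exact: lpaeq_Vghost.
Qed.

Lemma lpa_gtgt g : lpa_mul (lpa_pi (Gen g)) (lpa_pi (V (gtgt g))) = lpa_pi (Gen g).
Proof.
rewrite lpa_mulE; apply/lpa_piP; case: g => [u|e|e] /=.
- by have := lpaeq_VV u u; rewrite eqxx.
- exact: lpaeq_edgeV.
- exact: lpaeq_ghostV.
Qed.

Lemma lpa_VV u u' : u != u' -> lpa_mul (lpa_pi (V u)) (lpa_pi (V u')) = 0.
Proof.
move=> /negbTE uu'; rewrite lpa_mulE; apply/lpa_piP.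
by have := lpaeq_VV u u'; rewrite uu'.
Qed.

Lemma lpa_mul1l : left_id lpa_one lpa_mul.
Proof.
elim/lpa_ind; rewrite /lpa_one /one_term lpa_pi_big.
elim=> [g||s IHs t IHt|k t IHt|s IHs t IHt].
- rewrite -lpa_gsrc lpa_mulA lpa_suml (bigD1 (gsrc g)) //= big1 => [|u ug].
    by rewrite addr0 -[Gen (Vtx (gsrc g))]/(Gen (Vtx (gtgt (Vtx (gsrc g))))) lpa_gtgt.
  exact: lpa_VV.
- exact: lpa_mul0.
- by rewrite -lpa_addE lpa_mulDr IHs IHt.
- by rewrite -lpa_scaleE -lpa_scaleAr IHt.
- by rewrite -lpa_mulE lpa_mulA IHs.
Qed.

Lemma lpa_mul1r : right_id lpa_one lpa_mul.
Proof.
elim/lpa_ind; rewrite /lpa_one /one_term lpa_pi_big.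
elim=> [g||s IHs t IHt|k t IHt|s IHs t IHt].
- rewrite -lpa_gtgt -lpa_mulA lpa_sumr (bigD1 (gtgt g)) //= big1 => [|u ug].
    by rewrite addr0 -[Gen (Vtx (gtgt g))]/(Gen (Vtx (gtgt (Vtx (gtgt g))))) lpa_gtgt.
  by rewrite lpa_VV // eq_sym.
- exact: lpa_0mul.
- by rewrite -lpa_addE lpa_mulDl IHs IHt.
- by rewrite -lpa_scaleE -lpa_scaleAl IHt.
- by rewrite -lpa_mulE -lpa_mulA IHt.
Qed.

(* Only a [pzRingType]: the algebra of the graph without vertices is 0. *)
HB.instance Definition _ := GRing.Zmodule_isPzRing.Build LPA
  lpa_mulA lpa_mul1l lpa_mul1r lpa_mulDl lpa_mulDr.

Definition lpa_gen (g : generator E) : LPA := lpa_pi (Gen g).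

End Leavitt.

Section Series.
Variables (K : fieldType) (E : digraph) (w : vertex E).

(* X^E_w. The sink hypothesis, on which the type does not otherwise depend, is
   what makes it a module over L_K(E): without it the relation
   u = \sum_(s(e) = u) e e^* fails on the path of length 0 at w. *)
Definition pathseries (hw : is_sink w) : Type := pathto w -> K.

(* The coefficient of lambda in g xi is the sum of the coefficients of xi at
   the paths mu with g mu = lambda; by [path_actK] there is at most one such
   mu, namely g^* lambda. *)
Definition gen_act (g : generator E) (xi : pathto w -> K) : pathto w -> K :=
  fun lambda => oapp xi 0 (path_act (star g) lambda).

Fixpoint term_act (t : lterm K E) (xi : pathto w -> K) : pathto w -> K :=
  match t with
  | Gen g => gen_act g xi
  | Zero => fun=> 0
  | Add s t => fun lambda => term_act s xi lambda + term_act t xi lambda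
  | Scale k t => fun lambda => k * term_act t xi lambda
  | Mul s t => term_act s (term_act t xi)
  end.

Lemma term_act_ext t xi eta : xi =1 eta -> term_act t xi = term_act t eta.
Proof. by move=> /funext ->. Qed.

Lemma gen_act_lin g k xi eta lambda :
  gen_act g (fun l => k * xi l + eta l) lambda =
  k * gen_act g xi lambda + gen_act g eta lambda.
Proof.
by rewrite /gen_act; case: (path_act _ _) => //=; rewrite mulr0 addr0.
Qed.

Lemma term_act_lin t k xi eta lambda :
  term_act t (fun l => k * xi l + eta l) lambda =
  k * term_act t xi lambda + term_act t eta lambda.
Proof.
elim: t xi eta lambda => [g||s IHs t IHt|l t IHt|s IHs t IHt] xi eta lambda /=.
- exact: gen_act_lin.
- by rewrite mulr0 addr0.
- by rewrite IHs IHt mulrDr addrACA.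
- by rewrite IHt mulrDr !mulrA [l * k]mulrC.
- by rewrite -IHs (term_act_ext s (IHt xi eta)).
Qed.

Lemma term_actD t xi eta lambda :
  term_act t (fun l => xi l + eta l) lambda =
  term_act t xi lambda + term_act t eta lambda.
Proof.
have h : (fun l => xi l + eta l) =1 (fun l => 1 * xi l + eta l).
  by move=> l; rewrite mul1r.
by rewrite (term_act_ext t h) term_act_lin mul1r.
Qed.

Lemma term_act0 t lambda : term_act t (fun=> 0) lambda = 0.
Proof.
apply: (@addrI _ (term_act t (fun=> 0) lambda)); rewrite addr0 -term_actD.
by congr (_ lambda); apply: term_act_ext => l; rewrite addr0.
Qed.

Lemma term_actZ t k xi lambda :
  term_act t (fun l => k * xi l) lambda = k * term_act t xi lambda.
Proof.
have h : (fun l => k * xi l) =1 (fun l => k * xi l + 0).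
  by move=> l; rewrite addr0.
by rewrite (term_act_ext t h) term_act_lin term_act0 addr0.
Qed.

Definition coefat (xi : pathto w -> K) (p : prepath E) : K :=
  oapp xi 0 (insub p).

Lemma coefat_val xi (p : pathto w) : coefat xi (val p) = xi p.
Proof. by rewrite /coefat valK. Qed.

Lemma coefat_gen_act g xi p : ends_in w p ->
  coefat (gen_act g xi) p = oapp (coefat xi) 0 (prepath_act (star g) p).
Proof.
move=> hp; rewrite {1}/coefat (insubT (ends_in w) hp) /=.
rewrite /gen_act -[p in RHS]/(val (Sub p hp : pathto w)) -val_path_act.
by case: (path_act _ _) => //= q; rewrite coefat_val.
Qed.

Lemma gen_act2 g h xi lambda :
  gen_act g (gen_act h xi) lambda =
  oapp (coefat xi) 0
    (obind (prepath_act (star h)) (prepath_act (star g) (val lambda))).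
Proof.
rewrite -coefat_val coefat_gen_act; last exact: valP.
case E1: (prepath_act _ (val lambda)) => [p|] //=.
by rewrite coefat_gen_act // (prepath_act_ends (valP lambda) E1).
Qed.

Lemma gen_act1 g xi lambda :
  gen_act g xi lambda = oapp (coefat xi) 0 (prepath_act (star g) (val lambda)).
Proof. by rewrite -coefat_val coefat_gen_act //; exact: valP. Qed.

Lemma term_act_big (I : finType) (P : pred I) (F : I -> lterm K E) xi lambda :
  term_act (\big[@Add K E/Zero K E]_(i | P i) F i) xi lambda =
  \sum_(i | P i) term_act (F i) xi lambda.
Proof.
exact: (big_morph (fun t => term_act t xi lambda)).
Qed.

Lemma term_act_eq s t : is_sink w -> lpa_eq s t -> term_act s =2 term_act t.
Proof.
move=> hw; elim=> {s t} //=.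
- by move=> s t _ IH xi l; rewrite IH.
- by move=> s t u _ IH1 _ IH2 xi l; rewrite IH1 IH2.
- by move=> s s' t t' _ IH1 _ IH2 xi l; rewrite IH1 IH2.
- by move=> k t t' _ IH xi l; rewrite IH.
- move=> s s' t t' _ IH1 _ IH2 xi l; rewrite IH1.
  by rewrite (term_act_ext s' (IH2 xi)).
- by move=> ? ? ? xi l; rewrite addrA.
- by move=> ? ? xi l; rewrite addrC.
- by move=> ? xi l; rewrite add0r.
- by move=> ? xi l; rewrite mulN1r addNr.
- by move=> ? ? ? xi l; rewrite mulrA.
- by move=> ? xi l; rewrite mul1r.
- by move=> ? ? ? xi l; rewrite mulrDr.
- by move=> ? ? ? xi l; rewrite mulrDl.
- by move=> ? ? ? xi l; rewrite term_actD.
- by move=> ? ? ? xi l; rewrite term_actZ.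
- move=> u u' xi l; rewrite gen_act2 /=.
  case: (u =P u') => [->|ne] /=.
    by rewrite gen_act1 /=; case: eqP => //= ->; rewrite eqxx.
  by case: (_ =P u) => //= ->; case: eqP.
- move=> e xi [[u p] hp]; rewrite gen_act2 gen_act1 /=.
  case: p hp => [|f p] hp; case: (u =P _) => //= ne.
  case: eqP => //= fe; case: ne; move: hp => /andP[/= /andP[/eqP <- _] _].
  by rewrite fe.
- move=> e xi [[u p] hp]; rewrite gen_act2 gen_act1 /=.
  by case: p hp => [|f p] hp //=; case: eqP => //= _; rewrite eqxx.
- move=> e xi [[u p] hp]; rewrite gen_act2 gen_act1 /=.
  by rewrite eq_sym; case: eqP => //= ->; rewrite eqxx.
- move=> e xi [[u p] hp]; rewrite gen_act2 gen_act1 /=.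
  by case: eqP => //= _; rewrite eqxx.
- move=> e f xi [[u p] hp]; rewrite gen_act2 /=.
  case: (e =P f) => [->|ne] /=.
    by rewrite gen_act1 /= [u == _]eq_sym; case: eqP => //= <-; rewrite eqxx.
  by case: eqP => //= _; case: eqP => //= ef.
- move=> u nsu xi [[x p] hp]; rewrite term_act_big gen_act1 /=.
  case: p hp => [|f p] hp.
    rewrite big1 => [|e _]; last by rewrite /= gen_act2.
    case: eqP => //= xu; case: nsu; move: hp => /andP[_ /= /eqP <-] in hw *.
    by rewrite -xu.
  have fx : src f = x by case/andP: hp => /= /andP[/eqP].
  case: eqP => [xu|ne] /=.
    rewrite (bigD1 f) /=; last by rewrite fx xu.
    rewrite gen_act2 /= !eqxx /= eqxx /= fx big1 ?addr0 // => e /andP[_ ef].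
    by rewrite gen_act2 /= eq_sym (negbTE ef).
  rewrite big1 // => e /eqP eu; rewrite gen_act2 /=.
  by case: eqP => //= fe; case: ne; rewrite -fx fe.
Qed.

Variable hw : is_sink w.
Local Notation X := (pathseries hw).

HB.instance Definition _ := GRing.Zmodule.copy X (pathto w -> K).

Definition lpa_act (a : LPA K E) (xi : X) : X := term_act (lpa_repr a) xi.

Lemma lpa_actE t xi : lpa_act (lpa_pi t) xi = term_act t xi.
Proof.
by apply/funext => l; apply: term_act_eq => //; exact: lpa_repr_eq.
Qed.

Lemma lpa_actA a b xi : lpa_act a (lpa_act b xi) = lpa_act (a * b) xi.
Proof.
elim/lpa_ind: a => s; elim/lpa_ind: b => t.
by rewrite -[_ * _]/(lpa_mul _ _) lpa_mulE !lpa_actE.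
Qed.

Lemma lpa_act1 : left_id 1 lpa_act.
Proof.
move=> xi; rewrite -[1]/(lpa_one K E) lpa_actE; apply/funext => l.
rewrite term_act_big (bigD1 (psrc l)) //= big1 => [|u ul].
  by rewrite addr0 gen_act1 /= eqxx /= coefat_val.
by rewrite gen_act1 /= eq_sym (negbTE ul).
Qed.

Lemma lpa_actDr : right_distributive lpa_act +%R.
Proof.
by elim/lpa_ind=> t xi eta; rewrite !lpa_actE; apply/funext => l; exact: term_actD.
Qed.

Lemma lpa_actDl xi : {morph lpa_act^~ xi : a b / a + b}.
Proof.
elim/lpa_ind=> s; elim/lpa_ind=> t.
by rewrite -[_ + _]/(lpa_add _ _) lpa_addE !lpa_actE.
Qed.

HB.instance Definition _ := GRing.Zmodule_isLmodule.Build (LPA K E) X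
  lpa_actA lpa_act1 lpa_actDr lpa_actDl.

Lemma lpa_genZ g (xi : X) : lpa_gen K g *: xi = gen_act g xi.
Proof. exact: lpa_actE. Qed.

End Series.

Section PowerSeries.
Variable K : fieldType.

Definition pseries : Type := nat -> K.
HB.instance Definition _ := GRing.Zmodule.copy pseries (nat -> K).

Definition ps_mul (a b : pseries) : pseries :=
  fun n => \sum_(i < n.+1) a i * b (n - i)%N.
Definition ps_one : pseries := fun n => (n == 0)%:R.
Definition ps_of_poly (p : {poly K}) : pseries := fun n => p`_n.

Lemma ps_mul_poly (p q : {poly K}) :
  ps_mul (ps_of_poly p) (ps_of_poly q) = ps_of_poly (p * q).
Proof. by apply/funext => n; rewrite /ps_mul /ps_of_poly coefM. Qed.

Definition ps_trunc n (a : pseries) : {poly K} := \poly_(i < n.+1) a i.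

Lemma ps_mul_coef n a a' b b' :
  (forall i, (i <= n)%N -> a i = a' i) -> (forall i, (i <= n)%N -> b i = b' i) ->
  forall i, (i <= n)%N -> ps_mul a b i = ps_mul a' b' i.
Proof.
move=> ha hb i hi; apply: eq_bigr => j _; rewrite ha ?hb //.
  by apply: leq_trans hi; exact: leq_subr.
by apply: leq_trans hi; rewrite -ltnS.
Qed.

Lemma ps_truncE n a i : (i <= n)%N -> ps_of_poly (ps_trunc n a) i = a i.
Proof. by move=> hi; rewrite /ps_of_poly coef_poly ltnS hi. Qed.

Lemma ps_mulA : associative ps_mul.
Proof.
move=> a b c; apply/funext => n.
have ha i : (i <= n)%N -> a i = ps_of_poly (ps_trunc n a) i.
  by move=> hi; rewrite ps_truncE.
have hb i : (i <= n)%N -> b i = ps_of_poly (ps_trunc n b) i.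
  by move=> hi; rewrite ps_truncE.
have hc i : (i <= n)%N -> c i = ps_of_poly (ps_trunc n c) i.
  by move=> hi; rewrite ps_truncE.
rewrite (ps_mul_coef ha (ps_mul_coef hb hc)) //.
by rewrite (ps_mul_coef (ps_mul_coef ha hb) hc) // !ps_mul_poly mulrA.
Qed.

Lemma ps_mulC : commutative ps_mul.
Proof.
move=> a b; apply/funext => n.
have ha i : (i <= n)%N -> a i = ps_of_poly (ps_trunc n a) i.
  by move=> hi; rewrite ps_truncE.
have hb i : (i <= n)%N -> b i = ps_of_poly (ps_trunc n b) i.
  by move=> hi; rewrite ps_truncE.
by rewrite (ps_mul_coef ha hb) // (ps_mul_coef hb ha) // !ps_mul_poly mulrC.
Qed.

Lemma ps_mul1 : left_id ps_one ps_mul.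
Proof.
move=> a; apply/funext => n.
rewrite /ps_mul big_ord_recl /= mul1r subn0 big1 ?addr0 // => i _.
by rewrite /ps_one /= mul0r.
Qed.

Lemma ps_mulDl : left_distributive ps_mul +%R.
Proof.
move=> a b c; apply/funext => n; rewrite /ps_mul.
rewrite -[RHS]/(_ n + _ n) -big_split /=.
by apply: eq_bigr => i _; rewrite -mulrDl.
Qed.

HB.instance Definition _ := GRing.Zmodule_isComPzRing.Build pseries
  ps_mulA ps_mulC ps_mul1 ps_mulDl.

(* K[x]_M inside K[[x]]: the series f g^-1 with g(0) != 0. Here [h] is the
   inverse of [g] in K[[x]]. *)
Definition in_localisation (A : pseries) : Prop :=
  exists (f g : {poly K}) (h : pseries),
    [/\ g.[0] != 0, ps_of_poly g * h = 1 & A = ps_of_poly f * h].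

Lemma ps_of_polyM p q : ps_of_poly (p * q) = ps_of_poly p * ps_of_poly q.
Proof. by rewrite -ps_mul_poly. Qed.

Lemma ps_of_polyD p q : ps_of_poly (p + q) = ps_of_poly p + ps_of_poly q.
Proof. by apply/funext => n; rewrite /ps_of_poly coefD. Qed.

Lemma ps_of_poly1 : ps_of_poly 1 = 1.
Proof. by apply/funext => n; rewrite /ps_of_poly coef1. Qed.

Lemma in_loc_poly f : in_localisation (ps_of_poly f).
Proof.
by exists f, 1, 1; rewrite hornerC oner_neq0 ps_of_poly1 !mulr1.
Qed.

Lemma in_loc0 : in_localisation 0.
Proof.
have -> : 0 = ps_of_poly 0 by apply/funext => n; rewrite /ps_of_poly coef0.
exact: in_loc_poly.
Qed.

Lemma in_locD A B : in_localisation A -> in_localisation B ->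
  in_localisation (A + B).
Proof.
move=> [f [g [h [g0 gh ->]]]] [f' [g' [h' [g0' gh' ->]]]].
exists (f * g' + f' * g), (g * g'), (h * h'); split.
- by rewrite hornerM mulf_neq0.
- by rewrite ps_of_polyM mulrACA gh gh' mulr1.
- rewrite ps_of_polyD !ps_of_polyM mulrDl; congr (_ + _).
    by rewrite mulrACA gh' mulr1.
  by rewrite [h * h']mulrC mulrACA gh mulr1.
Qed.

Lemma in_locM A B : in_localisation A -> in_localisation B ->
  in_localisation (A * B).
Proof.
move=> [f [g [h [g0 gh ->]]]] [f' [g' [h' [g0' gh' ->]]]].
exists (f * f'), (g * g'), (h * h'); split.
- by rewrite hornerM mulf_neq0.
- by rewrite ps_of_polyM mulrACA gh gh' mulr1.
- by rewrite ps_of_polyM mulrACA.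
Qed.

Lemma ps_mulXE A n : (ps_of_poly 'X * A) n = if n is m.+1 then A m else 0.
Proof.
rewrite -[_ * _]/(ps_mul _ _) /ps_mul /ps_of_poly big_ord_recl coefX mul0r add0r.
case: n => [|n]; first by rewrite big_ord0.
rewrite big_ord_recl coefX /= mul1r subSS subn0 big1 ?addr0 // => i _.
by rewrite coefX /= mul0r.
Qed.

Lemma in_loc_shift A : in_localisation A -> in_localisation (fun n => A n.+1).
Proof.
move=> [f [g [h [g0 gh Af]]]].
pose f' := f - (A 0)%:P * g.
have AE : A - ps_of_poly (A 0)%:P = ps_of_poly f' * h.
  rewrite /f' -mulNr -polyCN ps_of_polyD ps_of_polyM mulrDl -Af -mulrA gh mulr1.
  congr (_ + _); apply/funext => n.
  by rewrite -[LHS]/(- (ps_of_poly _ n)) /ps_of_poly !coefC; case: ifP; rewrite ?oppr0.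
have g00 : g`_0 * h 0%N = 1.
  have := congr1 (fun s : pseries => s 0%N) gh.
  by rewrite -[LHS]/(ps_mul _ _ 0%N) /ps_mul big_ord1.
have h0 : h 0%N != 0 by apply/eqP => h0; move/eqP: g00; rewrite h0 mulr0 eq_sym oner_eq0.
have f'0 : root f' 0.
  rewrite /root horner_coef0.
  have := congr1 (fun s : pseries => s 0%N) AE.
  rewrite -[LHS]/(A 0%N - ps_of_poly _ 0%N) /ps_of_poly coefC eqxx subrr.
  rewrite -[RHS]/(ps_mul _ _ 0%N) /ps_mul big_ord1 => /esym/eqP.
  by rewrite mulf_eq0 (negbTE h0) orbF.
have [f'' f''E] := factor_theorem _ _ f'0; rewrite subr0 in f''E.
exists f'', g, h; split => //; apply/funext => n.
have := congr1 (fun s : pseries => s n.+1) AE.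
rewrite f''E [f'' * _]mulrC ps_of_polyM -mulrA ps_mulXE => <-.
by rewrite -[RHS]/(A n.+1 - ps_of_poly _ n.+1) /ps_of_poly coefC subr0.
Qed.

End PowerSeries.

Section D.
Variables (K : fieldType) (E : digraph) (c : edge E) (w : vertex E).

(* Y_{v,w} with v = s(c) *)
Definition first_edge_exit (mu : pathto w) : Prop :=
  psrc mu = src c /\
  exists d p, [/\ pedges mu = d :: p, src d = src c & d <> c].

Variables (hc : source_loop c) (hw : is_sink w).
Local Notation X := (pathseries K hw).

(* The series A_mu(x) attached to xi: its i-th coefficient is the coefficient
   of v xi at c^i mu. *)
Definition loop_series (xi : X) (mu : pathto w) : pseries K :=
  fun i => coefat (lpa_gen K (Vtx (src c)) *: xi) (src c, nseq i c ++ pedges mu).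

Definition in_D_prop (xi : X) : Prop :=
  forall mu : pathto w, first_edge_exit mu -> in_localisation (loop_series xi mu).

(* [hc] is only used to show that this subset is a submodule. *)
Definition in_D (_ : source_loop c) : {pred X} := fun xi => `[< in_D_prop xi >].

Lemma ends_in_loop (mu : pathto w) i : psrc mu = src c ->
  ends_in w (src c, nseq i c ++ pedges mu).
Proof.
have [cc _] := hc; move=> sm; elim: i => [|i] /=.
  by rewrite -sm /psrc /pedges -surjective_pairing; exact: valP.
by rewrite /ends_in /= eqxx -cc.
Qed.

Lemma loop_seriesE xi mu i : psrc mu = src c ->
  loop_series xi mu i = coefat xi (src c, nseq i c ++ pedges mu).
Proof.
move=> sm; rewrite /loop_series lpa_genZ coefat_gen_act /= ?eqxx //.
exact: ends_in_loop.
Qed.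

Lemma loop_seriesD xi eta mu :
  loop_series (xi + eta) mu = loop_series xi mu + loop_series eta mu.
Proof.
apply/funext => i; rewrite -[RHS]/(loop_series _ _ i + loop_series _ _ i).
by rewrite /loop_series scalerDr /coefat; case: insubP => //=; rewrite addr0.
Qed.

Lemma loop_series0 mu : loop_series 0 mu = 0.
Proof.
by apply/funext => i; rewrite /loop_series scaler0 /coefat; case: insubP.
Qed.

Lemma in_D_gen g xi : in_D_prop xi -> in_D_prop (lpa_gen K g *: xi).
Proof.
have [cc csl] := hc.
move=> hxi mu ymu; have [sm [d [p [mup sd dc]]]] := ymu.
have hA := hxi mu ymu; set A := loop_series xi mu in hA.
have AE i : A i = coefat xi (src c, nseq i c ++ d :: p).
  by rewrite /A loop_seriesE // mup.
have BE i : loop_series (lpa_gen K g *: xi) mu i =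
    oapp (coefat xi) 0 (prepath_act (star g) (src c, nseq i c ++ d :: p)).
  rewrite loop_seriesE // lpa_genZ coefat_gen_act; last exact: ends_in_loop.
  by rewrite mup.
case: g BE => [u|e|e] BE.
- case: (eqVneq (src c) u) => su.
    suff -> : loop_series (lpa_gen K (Vtx u) *: xi) mu = A by [].
    by apply/funext => i; rewrite BE /= su eqxx /= AE su.
  suff -> : loop_series (lpa_gen K (Vtx u) *: xi) mu = 0 by exact: in_loc0.
  by apply/funext => i; rewrite BE /= (negbTE su).
- case: (eqVneq c e) => ce.
    suff -> : loop_series (lpa_gen K (Edg e) *: xi) mu = ps_of_poly 'X * A.
      by apply: in_locM => //; exact: in_loc_poly.
    apply/funext => i; rewrite BE ps_mulXE -ce; case: i => [|i] /=.
      by case: eqP.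
    by rewrite eqxx /= AE -cc.
  suff -> : loop_series (lpa_gen K (Edg e) *: xi) mu =
      ps_of_poly (loop_series (lpa_gen K (Edg e) *: xi) mu 0%N)%:P.
    exact: in_loc_poly.
  apply/funext => -[|i]; rewrite /ps_of_poly coefC //= BE /=.
  by rewrite (negbTE ce).
- case: (eqVneq (tgt e) (src c)) => ec.
    have {}ec : e = c by apply: csl; rewrite ec.
    suff -> : loop_series (lpa_gen K (Gho e) *: xi) mu = (fun i => A i.+1).
      exact: in_loc_shift.
    by apply/funext => i; rewrite BE AE /= ec -cc eqxx.
  suff -> : loop_series (lpa_gen K (Gho e) *: xi) mu = 0 by exact: in_loc0.
  by apply/funext => i; rewrite BE /= (negbTE ec).
Qed.

Lemma in_D_add xi eta : in_D_prop xi -> in_D_prop eta -> in_D_prop (xi + eta).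
Proof.
move=> hxi heta mu ymu; rewrite loop_seriesD.
by apply: in_locD; [exact: hxi|exact: heta].
Qed.

Lemma in_D_scale (a : LPA K E) xi : in_D_prop xi -> in_D_prop (a *: xi).
Proof.
elim/lpa_ind: a => t.
elim: t xi => [g||s IHs t IHt|k t IHt|s IHs t IHt] xi hxi.
- exact: in_D_gen.
- rewrite -[lpa_pi _]/(0 : LPA K E) scale0r => mu _.
  by rewrite loop_series0; exact: in_loc0.
- rewrite -lpa_addE -[lpa_add _ _]/(lpa_pi s + lpa_pi t) scalerDl.
  by apply: in_D_add; [exact: IHs|exact: IHt].
- move=> mu ymu; have [sm _] := ymu.
  suff -> : loop_series (lpa_pi (Scale k t) *: xi) mu =
      ps_of_poly k%:P * loop_series (lpa_pi t *: xi) mu.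
    by apply: in_locM; [exact: in_loc_poly|exact: IHt].
  apply/funext => i; rewrite -[RHS]/(ps_mul _ _ i) /ps_mul big_ord_recl.
  rewrite big1 => [|j _]; last by rewrite /ps_of_poly coefC /= mul0r.
  rewrite /ps_of_poly coefC eqxx addr0 subn0 !loop_seriesE //.
  rewrite -![_ *: xi]/(lpa_act _ xi) !lpa_actE /coefat.
  by case: insubP => //=; rewrite mulr0.
- rewrite -lpa_mulE -[lpa_mul _ _]/(lpa_pi s * lpa_pi t) -scalerA.
  by apply: IHs; exact: IHt.
Qed.

Lemma in_D_closed : submod_closed (in_D hc).
Proof.
split; first by apply/asboolP => mu _; rewrite loop_series0; exact: in_loc0.
move=> a xi eta /asboolP hxi /asboolP heta; apply/asboolP.
by apply: in_D_add => //; exact: in_D_scale.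
Qed.

HB.instance Definition _ :=
  GRing.isSubmodClosed.Build (LPA K E) X (in_D hc) in_D_closed.

Definition DLw : Type := {xi : X | xi \in in_D hc}.
HB.instance Definition _ := SubChoice.on DLw.
HB.instance Definition _ := [SubChoice_isSubLmodule of DLw by <:].

End D.

Arguments DLw K {E c w} hc hw.

Section Modules.
Local Open Scope classical_set_scope.
Variables (R : pzRingType) (M : lmodType R).

Definition left_ideal (J : set R) : Prop :=
  [/\ J 0, forall x y, J x -> J y -> J (x + y) & forall r x, J x -> J (r * x)].

Definition principal_left_ideal (a : R) : set R := [set r * a | r in setT].

(* A homomorphism J -> M is represented by a function on R, of which only the
   restriction to J matters. *)
Definition left_hom_on (J : set R) (f : R -> M) : Prop :=
  (forall x y, J x -> J y -> f (x + y) = f x + f y) /\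
  (forall r x, J x -> f (r * x) = r *: f x).

Definition extends_homs (J : set R) : Prop :=
  forall f : R -> M, left_hom_on J f ->
    exists g : {linear R^o -> M}, forall x, J x -> g x = f x.

Definition divisible_module : Prop :=
  forall a : R, extends_homs (principal_left_ideal a).

Definition injective_module : Prop :=
  forall J : set R, left_ideal J -> extends_homs J.

End Modules.

(* Main.v *)
(** The module X = X^E_w is the K-dual of the right module w L, so every
    homomorphism from a left ideal to X is multiplication by some xi in X.
    Divisibility of D thus amounts to correcting, whenever a xi lies in D, the
    element xi to some eta in D with a eta = a xi; this works because X / D is a
    torsion-free module over K[x, x^-1].
    On the other hand lambda^* xi is a multiple of the path w for every xi in X,
    hence in D, and these products determine xi.  If D were injective, the
    homomorphism r |-> r xi on the left ideal of all r with r xi in D would be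
    multiplication by an element of D, which would have to be xi itself; but
    X <> D, since not every power series is rational. *)
From HB Require Import structures.
Require Import Defs.
From mathcomp Require Import all_boot all_order all_algebra.
From mathcomp Require Import boolp classical_sets functions.

Set Implicit Arguments.
Unset Strict Implicit.
Unset Printing Implicit Defensive.

Import GRing.Theory.
Local Open Scope ring_scope.

(** * Rational power series, and a series that is not rational *)

Section PowerSeriesTheory.
Variable K : fieldType.
Implicit Types (p q f g : {poly K}) (A h : pseries K).

Lemma ps_mulE A B n : (A * B) n = \sum_(i < n.+1) A i * B (n - i)%N.
Proof. by []. Qed.

Lemma ps_polyCM k A n : (ps_of_poly k%:P * A) n = k * A n.
Proof.
rewrite ps_mulE big_ord_recl subn0 /ps_of_poly coefC eqxx big1 ?addr0 // => i _.
by rewrite coefC mul0r.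
Qed.

Lemma coef_expXM_small q i n : (n < i)%N -> (('X * q) ^+ i)`_n = 0.
Proof. by move=> ni; rewrite exprMn coefXnM ni. Qed.

(* For y = X q, the inverse of 1 - y is the geometric series, whose
   coefficients are finite sums because the order of y^i is at least i. *)
Lemma ps_geometric_inverse q :
  exists h, ps_of_poly (1 - 'X * q) * h = 1.
Proof.
pose s n := \sum_(i < n.+1) ('X * q) ^+ i.
have s_stable n m : (n <= m)%N -> (s m)`_n = (s n)`_n.
  elim: m => [|m IHm]; first by rewrite leqn0 => /eqP ->.
  rewrite leq_eqVlt => /orP[/eqP -> //|nm].
  by rewrite /s big_ord_recr /= coefD coef_expXM_small // addr0 -IHm.
exists (fun n => (s n)`_n); apply/funext => n; rewrite ps_mulE.
transitivity (((1 - 'X * q) * s n)`_n).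
  by rewrite coefM; apply: eq_bigr => i _; rewrite (s_stable _ n) ?leq_subr.
rewrite /s -opprB mulNr -subrX1 opprB coefB coef_expXM_small // subr0.
by rewrite coef1.
Qed.

(** Dividing by [g.[0]] brings $g$ to the form [1 - 'X * q], which has a geometric inverse. *)
Lemma ps_of_poly_unit g : g.[0] != 0 -> exists h, ps_of_poly g * h = 1.
Proof.
move=> g0; set k := g.[0] in g0.
have /factor_theorem[q qE] : root (1 - k^-1 *: g) 0.
  by rewrite /root hornerD hornerN hornerZ hornerC mulVf // subrr.
rewrite subr0 mulrC in qE.
have gE : k^-1%:P * g = 1 - 'X * q by rewrite mul_polyC -qE opprB addrC subrK.
have [h hE] := ps_geometric_inverse q.
exists (ps_of_poly k^-1%:P * h).
by rewrite mulrA -ps_of_polyM mulrC [g * _]mulrC gE mulrC.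
Qed.

Lemma in_loc_divXn j A :
  in_localisation (ps_of_poly 'X^j * A) -> in_localisation A.
Proof.
elim: j A => [|j IHj] A; first by rewrite expr0 ps_of_poly1 mul1r.
rewrite exprSr ps_of_polyM -mulrA => /IHj /in_loc_shift.
by congr in_localisation; apply/funext => n; rewrite ps_mulXE.
Qed.

(** Write $p = q x^j$ with $q(0) \ne 0$: the factor $q$ is invertible in the localisation and $x^j$
    is undone by shifting. Thus $K[[x]]$ modulo the localisation is torsion-free over $K[x]$. *)
Lemma in_loc_divpoly p A :
  p != 0 -> in_localisation (ps_of_poly p * A) -> in_localisation A.
Proof.
move=> p0; have [j [q]] := multiplicity_XsubC p 0.
rewrite p0 /= subr0 => q0 ->; rewrite ps_of_polyM.
rewrite [ps_of_poly q * _]mulrC -mulrA => /in_loc_divXn qA.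
have [h hE] := ps_of_poly_unit q0.
have -> : A = h * (ps_of_poly q * A) by rewrite mulrA [h * _]mulrC hE mul1r.
by apply: in_locM qA; exists 1, q, h; rewrite ps_of_poly1 mul1r.
Qed.

(* The series \sum_k x^(2^k): its gaps are too long for a linear recurrence. *)
Definition lacunary : pseries K := fun n => (n == 2 ^ trunc_log 2 n)%N%:R.

Lemma lacunary_pow k : lacunary (2 ^ k)%N = 1.
Proof. by rewrite /lacunary trunc_expnK // eqxx. Qed.

Lemma lacunary_gap k n : (2 ^ k < n < 2 ^ k.+1)%N -> lacunary n = 0.
Proof.
move=> /andP[kn nk]; rewrite /lacunary (trunc_log_eq (n := k)) ?(ltnW kn) //.
by rewrite gtn_eqF.
Qed.

Lemma lacunary_not_in_loc : ~ in_localisation lacunary.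
Proof.
move=> [f [g [h [g0 gh AE]]]].
have fE : ps_of_poly g * lacunary = ps_of_poly f.
  by rewrite AE mulrCA gh mulr1.
(* In the coefficient of $gA$ at $2^{k+1}$, every term but the one with $g(0)$ falls into the gap
   above $2^k$, while $f$ has degree too small to contribute. *)
pose k := maxn (size f) (size g).
have kk : (k < 2 ^ k)%N by exact: ltn_expl.
have := congr1 (fun s : pseries K => s (2 ^ k.+1)%N) fE.
rewrite ps_mulE big_ord_recl subn0 lacunary_pow mulr1 big1 => [|i _].
  rewrite addr0 /ps_of_poly [RHS]nth_default => [/eqP|].
    by rewrite -horner_coef0 (negbTE g0).
  rewrite (leq_trans (leq_maxl _ (size g))) // -/k (leq_trans (ltnW kk)) //.
  by rewrite leq_exp2l.
have [ig|gi] := ltnP (lift ord0 i) (size g); last first.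
  by rewrite /ps_of_poly nth_default ?mul0r.
rewrite (@lacunary_gap k) ?mulr0 //.
have ik : (lift ord0 i < 2 ^ k)%N.
  by apply: leq_trans ig _; rewrite (leq_trans (leq_maxr (size f) _)) // ltnW.
apply/andP; split; last by rewrite ltn_subrL expn_gt0.
move: (nat_of_ord (lift ord0 i)) ik => m mk.
by rewrite ltn_subRL expnS mul2n -addnn ltn_add2r.
Qed.

End PowerSeriesTheory.

(** * Extension of linear functionals by Zorn's lemma *)

Section FunctionalExtension.
Local Open Scope classical_set_scope.
Variables (K : fieldType) (V : lmodType K).
Implicit Types (W H N : set V) (x y w : V).

Definition subspace W := W 0 /\ forall k x y, W x -> W y -> W (k *: x + y).

Lemma subspaceZ W k x : subspace W -> W x -> W (k *: x).
Proof. by move=> [W0 WL] Wx; rewrite -[_ *: _]addr0; exact: WL. Qed.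

Lemma subspaceB W x y : subspace W -> W x -> W y -> W (x - y).
Proof. by move=> [_ WL] Wx Wy; rewrite addrC -scaleN1r; exact: WL. Qed.

Lemma exists_hyperplane N w : subspace N -> ~ N w ->
  exists H, [/\ subspace H, N `<=` H, ~ H w &
    forall x, exists k, H (x - k *: w)].
Proof.
(* The subspace condition is put on $N \cup A$ so that the empty chain, whose union is empty,
   satisfies it too. *)
move=> subN Nw; pose P A := subspace (N `|` A) /\ ~ A w.
have [|A [[subH Aw] maxA]] := @Zorn_bigcup V P.
  move=> F FP Ftot; split; last by move=> [A /FP[_ Aw]].
  have both x y : (N `|` \bigcup_(A in F) A) x -> (N `|` \bigcup_(A in F) A) y ->
      (N x /\ N y) \/ exists A, [/\ F A, (N `|` A) x & (N `|` A) y].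
    move=> [Nx|[A FA Ax]] [Ny|[B FB By]]; first by left.
    - by right; exists B; split => //; [left|right].
    - by right; exists A; split => //; [right|left].
    - right; case: (Ftot _ _ FA FB) => sub.
        by exists B; split => //; right => //; exact: sub.
      by exists A; split => //; right => //; exact: sub.
  split=> [|k x y Fx Fy]; first by left; case: subN.
  have [[Nx Ny]|[A [FA Ax Ay]]] := both _ _ Fx Fy.
    by left; case: subN => _; exact.
  have [[_ AL] _] := FP _ FA.
  by have [Nz|Az] := AL k _ _ Ax Ay; [left|right; exists A].
have Hw : ~ (N `|` A) w by case.
exists (N `|` A); split=> // x.
apply: contrapT => noH.
(* If $x$ lies outside $H + Kw$, then $Kx + H$ is a larger subspace still avoiding $w$. *)
pose B := [set y | exists k h, (N `|` A) h /\ y = k *: x + h].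
have AB : A `<=` B.
  by move=> a Aa; exists 0, a; rewrite scale0r add0r; split => //; right.
have NB : N `<=` B.
  by move=> a Na; exists 0, a; rewrite scale0r add0r; split => //; left.
apply: (maxA B); [split=> // BA|split].
- have /BA Ax : B x by exists 1, 0; rewrite scale1r addr0; split => //; case: subH.
  by apply: noH; exists 0; rewrite scale0r subr0; right.
- rewrite setUidr //; split; first by apply: NB; case: subN.
  move=> k _ _ [a [h [Hh ->]]] [b [h' [Hh' ->]]].
  exists (k * a + b), (k *: h + h'); split; first by case: subH => _; exact.
  by rewrite scalerDr scalerA addrACA -scalerDl.
- move=> [k [h [Hh wE]]]; have [k0|k0] := eqVneq k 0.
    by apply: Hw; rewrite wE k0 scale0r add0r.
  apply: noH; exists k^-1; rewrite wE scalerDr scalerA mulVf // scale1r opprD.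
  by rewrite addNKr -scalerN -scaleN1r scalerA; exact: subspaceZ.
Qed.

(** For $f \ne 0$, the extension is the coordinate along some $w \in W$ with $f(w) = 1$, modulo a
    hyperplane that contains the kernel of $f$ but not $w$. *)
Lemma extend_functional W (f : V -> K) : subspace W ->
    (forall k x y, W x -> W y -> f (k *: x + y) = k * f x + f y) ->
  exists phi : V -> K, scalar phi /\ forall x, W x -> phi x = f x.
Proof.
move=> subW flin; have [W0 WL] := subW.
have f0 : f 0 = 0.
  apply: (@addrI _ (f 0)); rewrite addr0.
  by have := flin 1 0 0 W0 W0; rewrite scale1r addr0 mul1r.
have [f_eq0|/existsPNP[w1 Ww1 /eqP fw1]] := pselect (forall x, W x -> f x = 0).
  by exists (fun=> 0); split=> [k x y|x /f_eq0 //]; rewrite mulr0 addr0.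
have fZ k x : W x -> f (k *: x) = k * f x.
  by move=> Wx; have := flin k x 0 Wx W0; rewrite f0 !addr0.
pose w := (f w1)^-1 *: w1; have Ww : W w by exact: subspaceZ.
have fw : f w = 1 by rewrite fZ // mulVf.
pose N := [set x | W x /\ f x = 0].
have subN : subspace N.
  split=> // k x y [Wx fx] [Wy fy]; split; first exact: WL.
  by rewrite flin // fx fy mulr0 addr0.
have Nw : ~ N w by move=> [_ /eqP]; rewrite fw oner_eq0.
have [H [subH NH Hw Hsum]] := exists_hyperplane subN Nw.
have [phi phiP] := choice Hsum.
have phi_unique x k : H (x - k *: w) -> phi x = k.
  move=> Hk; apply/eqP; rewrite -subr_eq0; apply: contra_notT Hw => d0.
  have := subspaceZ (phi x - k)^-1 subH (subspaceB subH Hk (phiP x)).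
  by rewrite opprB [X in _ *: X]addrC addrA subrK -scalerBl scalerA mulVf // scale1r.
exists phi; split=> [k x y|x Wx]; apply: phi_unique.
  rewrite scalerDl -scalerA opprD addrACA -scalerBr.
  by case: subH => _; apply; exact: phiP.
apply: NH; split; first by apply: subspaceB => //; exact: subspaceZ.
by rewrite addrC -scaleNr flin // fw mulr1 addNr.
Qed.

End FunctionalExtension.

(** * Products of generators and ghost paths *)

Section LeavittAlgebra.
Variables (K : fieldType) (E : digraph).
Implicit Types (a b : LPA K E) (u x : vertex E) (e f : edge E).
Implicit Types (p q : seq (edge E)) (g h : generator E).

Local Notation V u := (lpa_gen K (Vtx u)).
Local Notation Ed e := (lpa_gen K (Edg e)).
Local Notation Gh e := (lpa_gen K (Gho e)).

Lemma lpa_scalerAl k a b : k *: (a * b) = (k *: a) * b.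
Proof. exact: lpa_scaleAl. Qed.

Lemma lpa_scalerAr k a b : k *: (a * b) = a * (k *: b).
Proof. exact: lpa_scaleAr. Qed.

Lemma lpa_genVV u x : V u * V x = if u == x then V u else 0.
Proof.
rewrite -[V u * V x]/(lpa_mul _ _) lpa_mulE.
have /lpa_piP -> := lpaeq_VV K u x.
by case: ifP.
Qed.

Lemma lpa_srcM g : V (gsrc g) * lpa_gen K g = lpa_gen K g.
Proof. exact: lpa_gsrc. Qed.

Lemma lpa_tgtM g : lpa_gen K g * V (gtgt g) = lpa_gen K g.
Proof. exact: lpa_gtgt. Qed.

Lemma lpa_genM0 g h : gtgt g != gsrc h -> lpa_gen K g * lpa_gen K h = 0.
Proof.
move=> gh; rewrite -lpa_tgtM -mulrA -(lpa_srcM h) (mulrA (V _)) lpa_genVV.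
by rewrite (negbTE gh) mul0r mulr0.
Qed.

Lemma lpa_GhEd e f : Gh e * Ed f = if e == f then V (tgt e) else 0.
Proof.
rewrite -[Gh e * Ed f]/(lpa_mul _ _) lpa_mulE.
have /lpa_piP -> := lpaeq_CK1 K e f.
by case: ifP.
Qed.

(* lambda^* for the path lambda with source u and edges p *)
Fixpoint ghost_path u p : LPA K E :=
  if p is e :: p' then ghost_path (tgt e) p' * Gh e else V u.

Lemma ghost_pathV u p : chain u p -> ghost_path u p * V u = ghost_path u p.
Proof.
case: p => [_|e p /= /andP[/eqP <- _]]; first exact: (lpa_tgtM (Vtx u)).
by rewrite -mulrA (lpa_tgtM (Gho e)).
Qed.

(** This is the involution applied to $g^*\lambda$; hence right multiplication preserves the span of
    the $\lambda^*$. *)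
Lemma ghost_path_gen w g (r : prepath E) : is_sink w -> ends_in w r ->
  ghost_path r.1 r.2 * lpa_gen K g =
  oapp (fun q : prepath E => ghost_path q.1 q.2) 0 (prepath_act (star g) r).
Proof.
case: r => u p /= sw /andP[/= up pw].
have uM h : u != gsrc h -> ghost_path u p * lpa_gen K h = 0.
  move=> uh; rewrite -ghost_pathV // -mulrA lpa_genM0 ?mulr0 //.
case: g => [x|e|e] /=.
- case: eqP => [<-|/eqP ux] /=; first exact: ghost_pathV.
  exact: uM.
(* The path of length 0 sits at the sink, where no edge starts, so the product vanishes. *)
- case: p up pw uM => [_ /= /eqP -> uM|f p /= /andP[/eqP fu fp] _ uM].
    by apply: (uM (Edg e)); apply/eqP => /esym; exact: sw.
  rewrite -mulrA lpa_GhEd; case: eqP => [<-|_] /=; first exact: ghost_pathV.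
  by rewrite mulr0.
- case: eqP => [<- //|/eqP eu] /=; apply: (uM (Gho e)) => /=.
  by rewrite eq_sym.
Qed.

End LeavittAlgebra.

(** * The series module as a dual space *)

Section SeriesModule.
Local Open Scope classical_set_scope.
Variables (K : fieldType) (E : digraph) (w : vertex E) (hw : is_sink w).
Local Notation L := (LPA K E).
Local Notation X := (pathseries K hw).
Implicit Types (xi zeta : X) (lambda : pathto w).

Lemma lpa_piZ t xi : lpa_pi t *: xi = term_act t xi.
Proof. exact: lpa_actE. Qed.

Lemma lpaZ_coef k (a : L) xi lambda : ((k *: a) *: xi) lambda = k * (a *: xi) lambda.
Proof.
elim/lpa_ind: a => t; rewrite -[_ *: lpa_pi t]/(lpa_scale _ _) lpa_scaleE.
by rewrite !lpa_piZ.
Qed.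

Lemma trivial_path_subproof : ends_in w (w, [::]).
Proof. exact: eqxx. Qed.

Definition trivial_path : pathto w := Sub (w, [::]) trivial_path_subproof.

Definition ghost lambda : L := ghost_path K (psrc lambda) (pedges lambda).

(** Each $e^*$ strips one leading edge, so $\lambda^*$ carries the coefficient at $\lambda$ down to
    the path of length 0. *)
Lemma ghost_coef lambda xi : (ghost lambda *: xi) trivial_path = xi lambda.
Proof.
rewrite -[RHS]coefat_val -[LHS]coefat_val.
rewrite /ghost /psrc /pedges SubK; case: lambda => [[u p] hp] /=.
elim: p u hp xi => [|e p IHp] u hp xi /=.
  have /eqP uw : u == w by case/andP: hp.
  by rewrite uw lpa_genZ coefat_gen_act /= ?eqxx // /ends_in /= eqxx.
have /andP[/= /andP[/eqP eu ep] pw] := hp.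
rewrite -scalerA IHp; last by rewrite /ends_in /= ep.
by rewrite lpa_genZ coefat_gen_act /= ?eqxx /= ?eu // /ends_in /= ep.
Qed.

Lemma ghost_tgt lambda : lpa_gen K (Vtx w) * ghost lambda = ghost lambda.
Proof.
rewrite /ghost /psrc /pedges; case: lambda => [[u p] /= /andP[_ /= /eqP <-]].
elim: p u => [|e p IHp] u /=; first exact: (lpa_tgtM K (Vtx u)).
by rewrite mulrA IHp.
Qed.

Lemma functional_term_act (phi : L -> K) t lambda : scalar phi ->
  phi (ghost lambda * lpa_pi t) =
  term_act t (fun mu => phi (ghost mu)) lambda.
Proof.
move=> phiL.
have phi0 : phi 0 = 0.
  apply: (@addrI _ (phi 0)); rewrite addr0.
  by have := phiL 1 0 0; rewrite scale1r addr0 mul1r.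
elim: t phi phiL phi0 lambda => [g||s IHs t IHt|k t IHt|s IHs t IHt] phi phiL phi0 lambda.
- rewrite [lpa_pi _]/(lpa_gen K g) (ghost_path_gen _ _ hw (valP lambda)) /= gen_act1.
  case E1: prepath_act => [q|] //=.
  have hq := prepath_act_ends (valP lambda) E1.
  by rewrite -[q]/(val (Sub q hq : pathto w)) coefat_val.
- by rewrite -[lpa_pi _]/(0 : L) mulr0 phi0.
- rewrite -lpa_addE -[lpa_add _ _]/(lpa_pi s + lpa_pi t) mulrDr /=.
  by rewrite -IHs // -IHt // -[ghost lambda * lpa_pi s]scale1r phiL mul1r scale1r.
- rewrite -lpa_scaleE -[lpa_scale _ _]/(k *: lpa_pi t) -lpa_scalerAr /=.
  by rewrite -IHt // -[k *: _]addr0 phiL phi0 addr0.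
- rewrite -lpa_mulE -[lpa_mul _ _]/(lpa_pi s * lpa_pi t) mulrA /=.
  (* A product replaces $\phi$ by another functional, so the induction ranges over all $\phi$. *)
  pose psi (a : L) := phi (a * lpa_pi t).
  rewrite -[LHS]/(psi (ghost lambda * lpa_pi s)) IHs.
  + by congr (_ lambda); apply: term_act_ext => mu; exact: IHt.
  + by move=> k a b; rewrite /psi mulrDl -lpa_scalerAl phiL.
  + by rewrite /psi mul0r.
Qed.

(* X is dual to the right module w L, of which the lambda^* form a K-basis:
   a homomorphism f on J is determined by the functional taking x to the
   coefficient of f(x) at the path of length 0. *)
Lemma series_extend (J : set L) (f : L -> X) :
  left_ideal J -> left_hom_on J f -> exists xi, forall x, J x -> f x = x *: xi.
Proof.
move=> [J0 JD JM] [fD fM].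
(* Scalars act as left multiplication by $k \cdot 1$, so left ideals are $K$-subspaces and $f$ is
   $K$-linear. *)
have scaleE k (x : L) : k *: x = (k *: (1 : L)) * x by rewrite -lpa_scalerAl mul1r.
have JZ k x : J x -> J (k *: x) by rewrite scaleE; exact: JM.
have [|k x y Jx Jy|phi [phiL phiE]] :=
  @extend_functional K L J (fun x => f x trivial_path).
- by split=> // k x y Jx Jy; apply: JD => //; exact: JZ.
- rewrite fD //; last exact: JZ.
  by rewrite scaleE fM // -[LHS]/(_ + f y _) lpaZ_coef scale1r.
pose xi : X := fun lambda => phi (ghost lambda).
exists xi => x Jx; apply/funext => lambda.
(* The coefficient of $f(x)$ at $\lambda$ is that of $f(\lambda^* x)$ at the path $w$, and
   $\lambda^* x \in J$, where $\phi$ is known. *)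
rewrite -ghost_coef -(fM (ghost lambda) x Jx) -(phiE _ (JM (ghost lambda) x Jx)).
rewrite -(lpa_reprK x) functional_term_act //.
by rewrite lpa_piZ.
Qed.

End SeriesModule.

(** * Evaluation of polynomials in the Leavitt path algebra *)

(* The library's horner_alg needs 1 <> 0, which fails in the algebra of the
   graph without vertices. *)
Section PolynomialEvaluation.
Variables (K : fieldType) (E : digraph) (x : LPA K E).
Local Notation L := (LPA K E).
Implicit Types p q : {poly K}.

Definition lpa_horner p : L := \sum_(i < size p) p`_i *: x ^+ i.

Lemma lpa_horner_wide p n : (size p <= n)%N ->
  lpa_horner p = \sum_(i < n) p`_i *: x ^+ i.
Proof.
move=> pn; rewrite /lpa_horner (big_ord_widen _ (fun i => p`_i *: x ^+ i) pn).
rewrite big_mkcond; apply: eq_bigr => i _; case: ltnP => // pi.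
by rewrite nth_default // scale0r.
Qed.

Lemma lpa_hornerD p q : lpa_horner (p + q) = lpa_horner p + lpa_horner q.
Proof.
rewrite (lpa_horner_wide (size_polyD p q)) (lpa_horner_wide (leq_maxl _ (size q))).
rewrite (lpa_horner_wide (leq_maxr (size p) _)) -big_split; apply: eq_bigr => i _.
by rewrite coefD scalerDl.
Qed.

Lemma lpa_hornerC k : lpa_horner k%:P = k *: (1 : L).
Proof.
rewrite (@lpa_horner_wide _ 1) ?size_polyC ?leq_b1 // big_ord1.
by rewrite coefC eqxx.
Qed.

Lemma lpa_hornerMX p : lpa_horner (p * 'X) = lpa_horner p * x.
Proof.
have sz : (size (p * 'X)%R <= (size p).+1)%N.
  by rewrite (leq_trans (size_polyMleq p 'X)) // size_polyX addn2.
rewrite (lpa_horner_wide sz) big_ord_recl coefMX scale0r add0r.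
rewrite [in RHS]/lpa_horner mulr_suml; apply: eq_bigr => i _.
by rewrite coefMX /= exprSr -lpa_scalerAl.
Qed.

Lemma lpa_hornerX : lpa_horner 'X = x.
Proof. by rewrite -['X]mul1r lpa_hornerMX lpa_hornerC scale1r mul1r. Qed.

Lemma lpa_hornerMC p k : lpa_horner (p * k%:P) = k *: lpa_horner p.
Proof.
rewrite mulrC mul_polyC (lpa_horner_wide (size_scale_leq k p)) scaler_sumr.
by apply: eq_bigr => i _; rewrite coefZ scalerA.
Qed.

Lemma lpa_hornerM p q : lpa_horner (p * q) = lpa_horner p * lpa_horner q.
Proof.
elim/poly_ind: q => [|q k IHq].
  by rewrite mulr0 {1 3}/lpa_horner size_poly0 !big_ord0 mulr0.
rewrite mulrDr mulrA lpa_hornerD lpa_hornerMX IHq lpa_hornerMC.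
by rewrite lpa_hornerD lpa_hornerMX lpa_hornerC mulrDr mulrA -lpa_scalerAr mulr1.
Qed.

Lemma lpa_horner_expX n : lpa_horner 'X^n = x ^+ n.
Proof.
elim: n => [|n IHn]; first by rewrite expr0 lpa_hornerC scale1r.
by rewrite exprSr lpa_hornerMX IHn -exprSr.
Qed.

End PolynomialEvaluation.

(** * Right multiplication by powers of the source loop *)

Section SourceLoop.
Variables (K : fieldType) (E : digraph) (c : edge E) (hc : source_loop c).
Local Notation L := (LPA K E).
Local Notation C := (lpa_gen K (Edg c)).
(** High powers of $c$ cancel $c^*$; other edges $e$ give $ec = 0$, since only $c$ enters its
    vertex, and $e^*c = 0$. The trailing factor $c$ hides the difference between $v$ and $1$. *)
Lemma loop_normal_form (a : L) :
  exists k (p : {poly K}), a * C ^+ k.+1 = lpa_horner C p * C.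
Proof.
have [cc csl] := hc; have sc : src c = tgt c by [].
elim/lpa_ind: a; elim=> [g||s [k [p IHs]] t [l [q IHt]]|m t [k [p IHt]]
    |s [k [p IHs]] t [l [q IHt]]].
- rewrite -[lpa_pi _]/(lpa_gen K g).
  have zero : gtgt g != src c -> exists k (p : {poly K}),
      lpa_gen K g * C ^+ k.+1 = lpa_horner C p * C.
    move=> gc; exists 0%N, 0; rewrite expr1 (lpa_genM0 K (h := Edg c)) //.
    by rewrite /lpa_horner size_poly0 big_ord0 mul0r.
  have [gc|] := eqVneq (gtgt g) (src c); last exact: zero.
  case: g gc zero => [u|e|e] /= gc _.
  + exists 0%N, 1; rewrite expr1 lpa_hornerC scale1r mul1r gc.
    exact: (lpa_srcM K (Edg c)).
  + have -> : e = c by apply: csl; rewrite -cc.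
    by exists 0%N, 'X; rewrite expr1 lpa_hornerX.
  + have [->|ec] := eqVneq e c.
      exists 1%N, 1; rewrite exprS expr1 mulrA lpa_GhEd eqxx.
      by rewrite lpa_hornerC scale1r mul1r -cc; exact: (lpa_srcM K (Edg c)).
    exists 0%N, 0; rewrite expr1 lpa_GhEd (negbTE ec).
    by rewrite /lpa_horner size_poly0 big_ord0 mul0r.
- exists 0%N, 0; rewrite -[lpa_pi _]/(0 : L) mul0r.
  by rewrite /lpa_horner size_poly0 big_ord0 mul0r.
- exists (k + l)%N, (p * 'X^l + q * 'X^k).
  rewrite -lpa_addE -[lpa_add _ _]/(lpa_pi s + lpa_pi t).
  rewrite lpa_hornerD !lpa_hornerM !lpa_horner_expX !mulrDl -addSn exprD mulrA IHs.
  rewrite -exprD addSnnS addnC exprD mulrA IHt.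
  by rewrite -!mulrA -!exprS -!exprSr.
- exists k, (p * m%:P).
  rewrite -lpa_scaleE -[lpa_scale _ _]/(m *: lpa_pi t).
  by rewrite lpa_hornerMC -!lpa_scalerAl IHt.
(* $c^{l+1}$ turns $t$ into $q(c)c$; the other $k+1$ factors commute past $q(c)$ to serve $s$, and
   the spare $c$ becomes ['X]. *)
- exists (l + k.+1)%N, (p * q * 'X).
  rewrite -lpa_mulE -[lpa_mul _ _]/(lpa_pi s * lpa_pi t).
  rewrite -addSn exprD mulrA -(mulrA _ _ (C ^+ l.+1)) IHt.
  have CM r : C * lpa_horner C r = lpa_horner C r * C.
    by rewrite -lpa_hornerMX mulrC lpa_hornerM lpa_hornerX.
  have CXM r : lpa_horner C r * C ^+ k.+2 = C ^+ k.+1 * (lpa_horner C r * C).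
    by rewrite -CM mulrA -exprSr -lpa_horner_expX -!lpa_hornerM mulrC.
  rewrite -mulrA -(mulrA _ C) -exprS CXM mulrA IHs -mulrA -lpa_hornerMX CM.
  by rewrite mulrA -lpa_hornerM mulrA.
Qed.

End SourceLoop.

(** * The submodule D and the quotient X / D *)

Section SubmoduleD.
Variables (K : fieldType) (E : digraph) (c : edge E) (w : vertex E).
Variables (hc : source_loop c) (hw : is_sink w).
Local Notation L := (LPA K E).
Local Notation X := (pathseries K hw).
Local Notation C := (lpa_gen K (Edg c)).
Local Notation C' := (lpa_gen K (Gho c)).
Implicit Types (xi zeta : X) (mu : pathto w).

(** Prefixing $c$ sends $c^i\mu$ to $c^{i+1}\mu$, and never yields $\mu$, whose first edge is an
    exit. *)
Lemma loop_series_loop xi mu : first_edge_exit c mu ->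
  loop_series c (C *: xi) mu = ps_of_poly 'X * loop_series c xi mu.
Proof.
move=> [sm [d [p [mup _ dc]]]]; have [cc _] := hc.
apply/funext => i; rewrite ps_mulXE loop_seriesE // lpa_genZ.
rewrite coefat_gen_act; last exact: ends_in_loop.
case: i => [|i] /=; first by rewrite mup; case: eqP.
by rewrite eqxx loop_seriesE // cc.
Qed.

Lemma loop_series_ghost xi mu : first_edge_exit c mu ->
  loop_series c (C' *: xi) mu = (fun i => loop_series c xi mu i.+1).
Proof.
move=> [sm [d [p [mup _ dc]]]]; have [cc _] := hc.
apply/funext => i; rewrite loop_seriesE // lpa_genZ.
rewrite coefat_gen_act; last exact: ends_in_loop.
by rewrite /= -cc eqxx loop_seriesE.
Qed.

Lemma loop_seriesZ k (a : L) xi mu : first_edge_exit c mu ->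
  loop_series c ((k *: a) *: xi) mu = ps_of_poly k%:P * loop_series c (a *: xi) mu.
Proof.
move=> [sm _]; apply/funext => i; rewrite ps_polyCM !loop_seriesE //.
by rewrite /coefat; case: insubP => [lambda _ _|_] /=; rewrite ?lpaZ_coef ?mulr0.
Qed.

Lemma loop_series_horner p xi mu : first_edge_exit c mu ->
  loop_series c (lpa_horner C p *: xi) mu = ps_of_poly p * loop_series c xi mu.
Proof.
move=> exit_mu; elim/poly_ind: p xi => [|p k IHp] xi.
  rewrite /lpa_horner size_poly0 big_ord0 scale0r loop_series0.
  by apply/funext => i; rewrite -polyC0 ps_polyCM mul0r.
rewrite lpa_hornerD scalerDl loop_seriesD ps_of_polyD mulrDl; congr (_ + _).
  by rewrite lpa_hornerMX -scalerA IHp loop_series_loop // ps_of_polyM mulrA.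
by rewrite lpa_hornerC loop_seriesZ // scale1r.
Qed.

Lemma in_D_propP xi : reflect (in_D_prop c xi) (xi \in in_D hc).
Proof. exact: asboolP. Qed.

(** $1 - cc^*$ leaves only the constant term of each $A_\mu$. *)
Lemma loop_head_in_D xi : xi - C *: (C' *: xi) \in in_D hc.
Proof.
apply/in_D_propP => mu exit_mu.
set z := C *: _; set A := loop_series c xi mu.
have -> : loop_series c (xi - z) mu = A - loop_series c z mu.
  by apply: (addIr (loop_series c z mu)); rewrite -loop_seriesD !subrK.
rewrite /z loop_series_loop // loop_series_ghost //.
suff -> : A - ps_of_poly 'X * (fun i => A i.+1) = ps_of_poly (A 0%N)%:P.
  exact: in_loc_poly.
apply/funext => i; rewrite -[LHS]/(A i - (ps_of_poly 'X * _) i) ps_mulXE.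
by rewrite /ps_of_poly coefC; case: i => [|i]; rewrite ?subr0 ?subrr.
Qed.

Lemma loop_tail_in_D n xi : xi - C ^+ n *: (C' ^+ n *: xi) \in in_D hc.
Proof.
elim: n xi => [|n IHn] xi; first by rewrite !scale1r subrr rpred0.
(* Telescoping: the induction hypothesis is applied to $c^*\xi$. *)
have -> : xi - C ^+ n.+1 *: (C' ^+ n.+1 *: xi) = (xi - C *: (C' *: xi)) +
    C *: (C' *: xi - C ^+ n *: (C' ^+ n *: (C' *: xi))).
  by rewrite (exprS C) (exprSr C') -!scalerA scalerBr addrA subrK.
by rewrite rpredD ?loop_head_in_D // rpredZ.
Qed.

(** On each $A_\mu$ the element $p(c)$ multiplies by $p(x)$, so torsion-freeness passes to X / D. *)
Lemma in_D_horner p xi : p != 0 ->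
  lpa_horner C p *: xi \in in_D hc -> xi \in in_D hc.
Proof.
move=> p0 /in_D_propP Dp; apply/in_D_propP => mu exit_mu.
by apply: (in_loc_divpoly p0); rewrite -loop_series_horner //; exact: Dp.
Qed.

(* X / D is killed by every vertex but s(c), so it is a module over
   K[c, c^*] = K[x, x^-1]. There a nonzero Laurent polynomial acts injectively,
   and an element a acting as 0 kills C^(k+1) X for some k, while
   X = D + C^(k+1) X. *)
Lemma solve_in_D (a : L) xi : a *: xi \in in_D hc ->
  exists2 eta, eta \in in_D hc & a *: eta = a *: xi.
Proof.
move=> Da; have [k [p aE]] := loop_normal_form hc a.
have Dt := loop_tail_in_D k.+1 xi; set tail := C' ^+ k.+1 *: xi in Dt.
have aCE : a *: (C ^+ k.+1 *: tail) = lpa_horner C p *: (C *: tail).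
  by rewrite scalerA aE -scalerA.
have [p0|p0] := eqVneq p 0.
  (* Here $a$ kills the subtracted tail, and the difference is in D. *)
  exists (xi - C ^+ k.+1 *: tail) => //.
  by rewrite scalerBr aCE p0 /lpa_horner size_poly0 big_ord0 scale0r subr0.
(* Here $\xi$ itself is in D: $p(c)c$ sends [tail] into D because $a\xi$ and the image under $a$ of
   $\xi - c^{k+1}$[tail] are there. *)
exists xi => //; rewrite -(subrK (C ^+ k.+1 *: tail) xi) rpredD //.
rewrite exprSr -scalerA rpredZ // (in_D_horner p0) // -aCE.
by rewrite -[_ *: _](subKr (a *: xi)) -scalerBr rpredB // rpredZ.
Qed.

(** $\lambda^*\xi$ is supported on paths starting at the sink $w$, whereas $v$ emits $c$; so
    $v\lambda^*\xi = 0$. *)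
Lemma ghost_in_D (lambda : pathto w) xi : ghost K lambda *: xi \in in_D hc.
Proof.
apply/in_D_propP => mu [sm _].
suff -> : loop_series c (ghost K lambda *: xi) mu = 0 by exact: in_loc0.
apply/funext => i; rewrite -ghost_tgt -scalerA loop_seriesE // lpa_genZ.
rewrite coefat_gen_act; last exact: ends_in_loop.
by rewrite /=; case: eqP => // /hw.
Qed.

(** Leading copies of $c$ are stripped; some edge remains, since powers of $c$ end at $v$, which is
    not a sink. *)
Lemma exists_exit_path : reaches (src c) w -> exists mu, first_edge_exit c mu.
Proof.
have [cc _] := hc; move=> [[[u p] /= hp] /= uc]; rewrite /psrc /= in uc.
rewrite {u}uc in hp; elim: p hp => [|e p IHp] hp.
  by case/andP: hp => _ /eqP /= /hw.
have [ec|ec] := eqVneq e c.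
  apply: IHp; move: hp; rewrite /ends_in /= ec cc.
  by case/andP=> /andP[_ ->].
exists (Sub (src c, e :: p) hp); split; first by rewrite /psrc SubK.
exists e, p; split; first by rewrite /pedges SubK.
  by case/andP: hp => /= /andP[/eqP].
exact/eqP.
Qed.

Lemma exists_not_in_D : reaches (src c) w -> exists xi, xi \notin in_D hc.
Proof.
move=> /exists_exit_path[mu exit_mu]; have [sm _] := exit_mu.
(* The shift by the length of $\mu$ places the $i$-th lacunary coefficient at $c^i\mu$. *)
pose xi : X :=
  fun lambda => lacunary K (size (pedges lambda) - size (pedges mu))%N.
exists xi; apply/in_D_propP => /(_ mu exit_mu).
suff -> : loop_series c xi mu = lacunary K by exact: lacunary_not_in_loc.
apply/funext => i; rewrite loop_seriesE // /coefat.
rewrite (insubT (ends_in w) (ends_in_loop hc i sm)) /=.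
by rewrite /xi /pedges SubK /= size_cat size_nseq addnK.
Qed.

End SubmoduleD.

(** * Divisibility and non-injectivity of D *)

Lemma exists_scale_linear (R : pzRingType) (M : lmodType R) (m : M) :
  exists g : {linear R^o -> M}, forall r : R, g r = r *: m.
Proof.
pose phi : R^o -> M := fun r : R => r *: m.
have lin : linear phi by move=> k r s; rewrite /phi scalerDl -scalerA.
pose g : {linear R^o -> M} :=
  HB.pack phi (GRing.isLinear.Build R R^o M *:%R phi lin).
by exists g.
Qed.

Lemma DLw_divisible (K : fieldType) (E : digraph) (c : edge E) (w : vertex E)
  (hc : source_loop c) (hw : is_sink w) : divisible_module (DLw K hc hw).
Proof.
move=> a f [fD fM].
have Jideal : left_ideal (principal_left_ideal a).
  split=> [|_ _ [r _ <-] [s _ <-]|r _ [s _ <-]].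
  - by exists 0 => //; rewrite mul0r.
  - by exists (r + s) => //; rewrite mulrDl.
  - by exists (r * s) => //; rewrite mulrA.
have Ja : principal_left_ideal a a by exists 1; rewrite ?mul1r.
(* Followed by the inclusion of D in X, $f$ becomes multiplication by some $\xi$ in X. *)
have [|xi xiE] := @series_extend K E w hw _ (fun x => val (f x)) Jideal.
  by split=> [x y Jx Jy|r x Jx]; rewrite ?fD ?fM.
have Daxi : a *: xi \in in_D hc by rewrite -xiE //; exact: valP.
have [eta Deta aeta] := solve_in_D Daxi.
have [g gE] := exists_scale_linear (Sub eta Deta : DLw K hc hw).
exists g => _ [r _ <-]; apply: val_inj.
by rewrite gE fM //= xiE // -aeta scalerA.
Qed.

Lemma DLw_not_injective (K : fieldType) (E : digraph) (c : edge E) (w : vertex E)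
  (hc : source_loop c) (hw : is_sink w) :
  reaches (src c) w -> ~ injective_module (DLw K hc hw).
Proof.
move=> vw Dinj; have [xi /negP xiD] := exists_not_in_D K hc hw vw.
pose J : set (LPA K E) := fun r => r *: xi \in in_D hc.
(* The default 0 occurs only outside $J$. *)
pose f (r : LPA K E) : DLw K hc hw := insubd 0 (r *: xi).
have fE r : J r -> val (f r) = r *: xi by move=> Jr; rewrite insubdK.
have Jideal : left_ideal J.
  split=> [|r s Jr Js|r s Js]; rewrite /J.
  - by rewrite scale0r rpred0.
  - by rewrite scalerDl rpredD.
  - by rewrite -scalerA rpredZ.
have [J0 JD JM] := Jideal.
have [|g gE] := Dinj J Jideal f.
  split=> [r s Jr Js|r s Js]; apply: val_inj.
    by rewrite fE ?raddfD /= ?fE ?scalerDl //; exact: JD.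
  by rewrite fE ?linearZ /= ?fE ?scalerA //; exact: JM.
apply: xiD; suff -> : xi = val (g 1) by exact: valP.
(* Every $\lambda^*$ lies in $J$, so $\xi$ and $g(1)$ have the same product with it. *)
apply/funext => lambda; rewrite -[LHS]ghost_coef -[RHS]ghost_coef.
have Jl : J (ghost K lambda) by exact: ghost_in_D.
rewrite -fE // -gE // -[X in g X]mulr1 -[_ * 1]/(ghost K lambda *: (1 : (LPA K E)^o)).
by rewrite linearZ.
Qed.

Theorem mainTheorem1 (K : fieldType) (E : digraph) (c : edge E) (w : vertex E)
    (hc : source_loop c) (hw : is_sink w) (hvw : reaches (src c) w) :
  divisible_module (DLw K hc hw) /\ ~ injective_module (DLw K hc hw).
Proof.
by split; [exact: DLw_divisible|exact: DLw_not_injective].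
Qed.
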